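(* Let $\mathcal E_L$ be the set of $\mathcal{E}$-formulas over $L$ and let $\mathcal E_L/{\approx}$ be its quotient under $\approx$, partially ordered by $[E]\le[E']$ iff $E\preceq E'$. Then $\mathcal E_L/{\approx}$ is a complete lattice whose smallest element is the class of $\mathit{False}$ and whose greatest element is the class of $\mathit{True}$.
   Context: $L$ is a first-order language with equality whose function symbols include at least one constant. An $\mathcal{E}$-formula over $L$ is a formula built from the propositional constants $\mathit{True}$, $\mathit{False}$ and equations $s=t$ between terms of $L$ using only $\wedge$ and the existential quantifier $\exists$. $\mathrm{FEA}(L)$ (free equality axioms) is the theory consisting of $f(x_1,\dots,x_n)=f(y_1,\dots,y_n)\leftrightarrow x_1=y_1\wedge\dots\wedge x_n=y_n$ for each $n$-ary function symbol $f$; $f(x_1,\dots,x_n)=g(y_1,\dots,y_m)\leftrightarrow\mathit{False}$ for distinct function symbols $f,g$; and $x=t\leftrightarrow\mathit{False}$ whenever $x\not\equiv t$ and $x$ occurs in $t$. For $\mathcal{E}$-formulas, $E\preceq E'$ iff $\mathrm{FEA}(L)\models E\rightarrow E'$, and $E\approx E'$ iff $\mathrm{FEA}(L)\models E\leftrightarrow E'$. *)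

(* Defs.v *)
From HB Require Import structures.
From mathcomp Require Import all_boot all_order.
From mathcomp Require Import boolp classical_sets.

Set Implicit Arguments.
Unset Strict Implicit.
Unset Printing Implicit Defensive.

Local Open Scope classical_set_scope.
Local Open Scope quotient_scope.

(* First-order languages; equality is a logical symbol, not one of [rsym].
   No cardinality or decidability restriction is put on the symbols.
   Constants are the function symbols of arity 0. *)
Record language := Language {
  fsym : Type;
  farity : fsym -> nat;
  rsym : Type;
  rarity : rsym -> nat
}.

Definition has_constant (L : language) : Prop :=
  exists c : fsym L, farity c = 0.

(* The variables are x_0, x_1, x_2, ..., named by natural numbers. *)
Inductive term (L : language) : Type :=
| Var of nat
| App (f : fsym L) of ('I_(farity f) -> term L).
Arguments Var {L}.
Arguments App {L}.

Fixpoint occurs (L : language) (x : nat) (t : term L) : Prop :=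
  match t with
  | Var y => x = y
  | App f a => exists i, occurs x (a i)
  end.

Inductive formula (L : language) : Type :=
| FTrue
| FFalse
| FEq of term L & term L
| FRel (r : rsym L) of ('I_(rarity r) -> term L)
| FNot of formula L
| FAnd of formula L & formula L
| FOr of formula L & formula L
| FImp of formula L & formula L
| FIff of formula L & formula L
| FForall of nat & formula L
| FExists of nat & formula L.
Arguments FTrue {L}.
Arguments FFalse {L}.
Arguments FRel {L}.

Record structure (L : language) := Structure {
  carrier :> Type;
  carrier_inhabited : inhabited carrier;
  finterp : forall f : fsym L, ('I_(farity f) -> carrier) -> carrier;
  rinterp : forall r : rsym L, ('I_(rarity r) -> carrier) -> Prop
}.
Arguments finterp {L} s f _.
Arguments rinterp {L} s r _.

Definition valuation (L : language) (M : structure L) := nat -> M.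

Definition update (L : language) (M : structure L) (v : valuation M)
    (x : nat) (d : M) : valuation M :=
  fun y => if y == x then d else v y.

Fixpoint eval (L : language) (M : structure L) (v : valuation M)
    (t : term L) : M :=
  match t with
  | Var x => v x
  | App f a => finterp M f (fun i => eval v (a i))
  end.

Fixpoint sat (L : language) (M : structure L) (v : valuation M)
    (A : formula L) : Prop :=
  match A with
  | FTrue => True
  | FFalse => False
  | FEq s t => eval v s = eval v t
  | FRel r a => rinterp M r (fun i => eval v (a i))
  | FNot B => ~ sat v B
  | FAnd B C => sat v B /\ sat v C
  | FOr B C => sat v B \/ sat v C
  | FImp B C => sat v B -> sat v C
  | FIff B C => sat v B <-> sat v C
  | FForall x B => forall d : M, sat (update v x d) B
  | FExists x B => exists d : M, sat (update v x d) B
  end.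

(* Free variables are read universally, in axioms as well as in consequences. *)
Definition valid (L : language) (M : structure L) (A : formula L) : Prop :=
  forall v : valuation M, sat v A.

Definition entails (L : language) (T : set (formula L)) (A : formula L) : Prop :=
  forall M : structure L, (forall B, T B -> valid M B) -> valid M A.

Definition big_and (L : language) (n : nat) (A : 'I_n -> formula L) : formula L :=
  \big[@FAnd L/FTrue]_(i < n) A i.

(* In the first two schemes the variables x_1, ..., x_n, y_1, ..., y_m are
   taken to be number 0, ..., n - 1, n, ..., n + m - 1, which loses nothing
   since axioms are read universally. *)
Inductive FEA (L : language) : set (formula L) :=
| FEA_inj (f : fsym L) :
    FEA (FIff
      (FEq (App f (fun i => Var i)) (App f (fun i => Var (farity f + i))))
      (big_and (fun i : 'I_(farity f) => FEq (Var i) (Var (farity f + i)))))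
| FEA_clash (f g : fsym L) : f <> g ->
    FEA (FIff
      (FEq (App f (fun i => Var i)) (App g (fun j => Var (farity f + j))))
      FFalse)
| FEA_occur (x : nat) (t : term L) : Var x <> t -> occurs x t ->
    FEA (FIff (FEq (Var x) t) FFalse).

Fixpoint is_Eformula (L : language) (A : formula L) : bool :=
  match A with
  | FTrue | FFalse | FEq _ _ => true
  | FAnd B C => is_Eformula B && is_Eformula C
  | FExists _ B => is_Eformula B
  | _ => false
  end.

HB.instance Definition _ (L : language) := gen_eqMixin (formula L).
HB.instance Definition _ (L : language) := gen_choiceMixin (formula L).

Definition Eformula (L : language) := {A : formula L | is_Eformula A}.

HB.instance Definition _ (L : language) := Choice.on (Eformula L).

Definition ETrue (L : language) : Eformula L := exist _ FTrue isT.
Definition EFalse (L : language) : Eformula L := exist _ FFalse isT.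

Definition Ele (L : language) (E E' : Eformula L) : Prop :=
  entails (@FEA L) (FImp (val E) (val E')).

Definition Eequiv (L : language) (E E' : Eformula L) : Prop :=
  entails (@FEA L) (FIff (val E) (val E')).

Lemma Ele_refl (L : language) (E : Eformula L) : Ele E E.
Proof. by move=> M _ v. Qed.

Lemma Ele_trans (L : language) (E2 E1 E3 : Eformula L) :
  Ele E1 E2 -> Ele E2 E3 -> Ele E1 E3.
Proof. by move=> h12 h23 M hM v /(h12 M hM v)/(h23 M hM v). Qed.

Lemma EequivE (L : language) (E E' : Eformula L) :
  Eequiv E E' <-> Ele E E' /\ Ele E' E.
Proof.
split=> [h|[h h'] M hM v]; last by split; [exact: h | exact: h'].
by split=> M hM v; have [] := h M hM v.
Qed.

Definition Eequivb (L : language) : rel (Eformula L) :=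
  fun E E' => `[< Eequiv E E' >].

Lemma Eequivb_refl (L : language) : reflexive (@Eequivb L).
Proof. by move=> E; apply/asboolP/EequivE; split; exact: Ele_refl. Qed.

Lemma Eequivb_sym (L : language) : symmetric (@Eequivb L).
Proof.
by move=> E E'; apply/asboolP/asboolP => /EequivE[? ?]; apply/EequivE.
Qed.

Lemma Eequivb_trans (L : language) : transitive (@Eequivb L).
Proof.
move=> E2 E1 E3 /asboolP/EequivE[h12 h21] /asboolP/EequivE[h23 h32].
by apply/asboolP/EequivE; split; apply: (Ele_trans (E2 := E2)).
Qed.

Canonical Eequiv_rel (L : language) : equiv_rel (Eformula L) :=
  EquivRel (@Eequivb L) (@Eequivb_refl L) (@Eequivb_sym L) (@Eequivb_trans L).

Definition Equot (L : language) := {eq_quot (Eequiv_rel L)}.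

HB.instance Definition _ (L : language) := EqQuotient.on (Equot L).
HB.instance Definition _ (L : language) := Choice.on (Equot L).

Definition Eclass (L : language) (E : Eformula L) : Equot L := \pi_(Equot L) E.

Lemma EclassP (L : language) (E E' : Eformula L) :
  Eclass E = Eclass E' <-> Eequiv E E'.
Proof. by split=> [/eqmodP/asboolP | h]; last exact/eqmodP/asboolP. Qed.

(* Defined on representatives; [Equot_leP] shows that the choice is immaterial. *)
Definition Equot_le (L : language) : rel (Equot L) :=
  fun p q => `[< Ele (repr p) (repr q) >].

Lemma repr_Eclass (L : language) (E : Eformula L) :
  Ele (repr (Eclass E)) E /\ Ele E (repr (Eclass E)).
Proof. by apply/EequivE/EclassP; rewrite /Eclass reprK. Qed.

Lemma Equot_le_refl (L : language) : reflexive (@Equot_le L).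
Proof. by move=> p; apply/asboolP; exact: Ele_refl. Qed.

Lemma Equot_le_anti (L : language) : antisymmetric (@Equot_le L).
Proof.
move=> p q /andP[/asboolP hpq /asboolP hqp].
rewrite -[p]reprK -[q]reprK.
by apply/EclassP/EequivE.
Qed.

Lemma Equot_le_trans (L : language) : transitive (@Equot_le L).
Proof.
by move=> q p r /asboolP hpq /asboolP hqr; apply/asboolP/(Ele_trans hpq hqr).
Qed.

Fact Equot_display : Order.disp_t. Proof. exact: Order.Disp tt tt. Qed.

HB.instance Definition _ (L : language) :=
  Order.Le_isPOrder.Build Equot_display (Equot L)
    (@Equot_le_refl L) (@Equot_le_anti L) (@Equot_le_trans L).

Lemma Equot_leP (L : language) (E E' : Eformula L) :
  (Eclass E <= Eclass E')%O <-> Ele E E'.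
Proof.
have [h1 h2] := repr_Eclass E; have [h3 h4] := repr_Eclass E'.
split=> [/asboolP h | h].
  exact: Ele_trans h2 (Ele_trans h h3).
by apply/asboolP; exact: Ele_trans h1 (Ele_trans h h4).
Qed.

Definition complete_lattice (d : Order.disp_t) (T : porderType d) : Prop :=
  forall A : set T, supremums A !=set0 /\ infimums A !=set0.

(* Main.v *)
(* An E-formula without solution in any model of FEA is equivalent to False; by
   unification, the solutions of any other one are, in every model of FEA at
   once, the instances of a single substitution, so that [Ele] becomes the
   subsumption order. In a term tuple, the number of symbol and variable
   occurrences minus the number of distinct variables strictly increases under
   instantiation except by renamings. Hence, above a satisfiable E, a nonempty set of E-formulas closed
   under conjunction has a least element, namely one of maximal rank. Applied to
   the upper bounds of a set containing E this gives suprema, and infima are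
   suprema of lower bounds. *)
From HB Require Import structures.
From Stdlib Require Import Eqdep_dec.
Require Import Defs.
From mathcomp Require Import all_boot all_order.
From mathcomp Require Import boolp classical_sets zify.

Set Implicit Arguments.
Unset Strict Implicit.
Unset Printing Implicit Defensive.

HB.instance Definition _ (L : language) := gen_eqMixin (term L).

(** * Models of the free equality axioms *)

Lemma big_and_sat (L : language) (M : structure L) (v : valuation M) (n : nat)
    (A : 'I_n -> formula L) :
  sat v (big_and A) <-> forall i, sat v (A i).
Proof.
rewrite /big_and; elim: n A => [|n IH] A.
  by rewrite big_ord0; split=> // _ [].
rewrite big_ord_recl /=; split=> [[h0 /IH h] i|h].
  by case: (unliftP ord0 i) => [j ->|->].
by split=> //; apply/IH => i.
Qed.

Definition FEA_model (L : language) (M : structure L) : Prop :=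
  forall B, FEA B -> valid M B.

(* Follows the numbering of the variables in the first two schemes of [FEA]; the
   default [d] is only reached from n + m on. *)
Definition cat_val (T : Type) (d : T) (n m : nat) (a : 'I_n -> T) (b : 'I_m -> T)
    (k : nat) : T :=
  if insub k is Some i then a i else
  if insub (k - n) is Some j then b j else d.

Lemma cat_vall (T : Type) (d : T) n m (a : 'I_n -> T) (b : 'I_m -> T) (i : 'I_n) :
  cat_val d a b i = a i.
Proof. by rewrite /cat_val valK. Qed.

Lemma cat_valr (T : Type) (d : T) n m (a : 'I_n -> T) (b : 'I_m -> T) (j : 'I_m) :
  cat_val d a b (n + j) = b j.
Proof. by rewrite /cat_val insubN ?addKn ?valK // -leqNgt leq_addr. Qed.

Lemma FEA_model_inj (L : language) (M : structure L) (f : Defs.fsym L)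
    (a b : 'I_(farity f) -> M) :
  FEA_model M -> finterp M f a = finterp M f b -> a = b.
Proof.
move=> hM e; have [d] := carrier_inhabited M.
have /= [+ _] := hM _ (FEA_inj f) (cat_val d a b).
have -> : (fun i : 'I__ => cat_val d a b i) = a.
  by apply/funext => i; rewrite cat_vall.
have -> : (fun i : 'I__ => cat_val d a b (farity f + i)) = b.
  by apply/funext => i; rewrite cat_valr.
move=> /(_ e) /big_and_sat h; apply/funext => i.
by have /= := h i; rewrite cat_vall cat_valr.
Qed.

Lemma FEA_model_clash (L : language) (M : structure L) (f g : Defs.fsym L)
    (a : 'I_(farity f) -> M) (b : 'I_(farity g) -> M) :
  FEA_model M -> finterp M f a = finterp M g b -> f = g.
Proof.
move=> hM e; case: (pselect (f = g)) => // fg; have [d] := carrier_inhabited M.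
have /= [+ _] := hM _ (FEA_clash fg) (cat_val d a b).
have -> : (fun i : 'I__ => cat_val d a b i) = a.
  by apply/funext => i; rewrite cat_vall.
have -> : (fun i : 'I__ => cat_val d a b (farity f + i)) = b.
  by apply/funext => i; rewrite cat_valr.
by move=> /(_ e).
Qed.

(** * The term algebra and substitutions *)

Definition term_algebra (L : language) : structure L :=
  Structure (inhabits (Var 0)) (@App L) (fun _ _ => False).

(** As valuations in the term algebra, substitutions inherit every fact proved about [eval] in an
    arbitrary structure. *)
Definition substitution (L : language) := valuation (term_algebra L).

Definition subst (L : language) (s : substitution L) (t : term L) : term L :=
  eval s t.

Lemma subst_id (L : language) (t : term L) : subst Var t = t.
Proof.
elim: t => //= f a IH; rewrite /subst /=; congr App.
by apply/funext => i; exact: IH.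
Qed.

Fixpoint tvars (L : language) (t : term L) : seq nat :=
  match t with
  | Var x => [:: x]
  | App f a => flatten [seq tvars (a i) | i <- enum 'I_(farity f)]
  end.

Fixpoint tsize (L : language) (t : term L) : nat :=
  match t with
  | Var x => 1
  | App f a => (\sum_(i <- enum 'I_(farity f)) tsize (a i)).+1
  end.

Lemma tsize_gt0 (L : language) (t : term L) : 0 < tsize t.
Proof. by case: t. Qed.

Lemma tvars_arg (L : language) (f : Defs.fsym L) (a : 'I_(farity f) -> term L) i :
  {subset tvars (a i) <= tvars (App f a)}.
Proof. by move=> x xi; apply/flatten_mapP; exists i => //; rewrite mem_enum. Qed.

Lemma occurs_tvars (L : language) (x : nat) (t : term L) :
  occurs x t <-> x \in tvars t.
Proof.
elim: t => [y|f a IH] /=; first by rewrite inE; split=> /eqP.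
split=> [[i /IH]|/flatten_mapP[i _ /IH]]; last by exists i.
exact: tvars_arg.
Qed.

Lemma tsize_arg (L : language) (f : Defs.fsym L) (a : 'I_(farity f) -> term L) i :
  tsize (a i) < tsize (App f a).
Proof.
rewrite /= ltnS (big_rem i) ?mem_enum //=; exact: leq_addr.
Qed.

Lemma tsize_subst_ge (L : language) (s : substitution L) (x : nat) (t : term L) :
  x \in tvars t -> tsize (s x) <= tsize (subst s t).
Proof.
elim: t => [y|f a IH] /=; first by rewrite inE => /eqP ->.
move=> /flatten_mapP[i _ /IH /leq_trans]; apply; apply: ltnW.
exact: (tsize_arg (fun j => subst s (a j))).
Qed.

(** The first two schemes hold because [App] is a free constructor. For the third, the instance of a
    variable is strictly smaller than the same instance of a compound term containing it. *)
Lemma FEA_model_term_algebra (L : language) : FEA_model (term_algebra L).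
Proof.
move=> _ [f|f g fg|x t xt /occurs_tvars xin] v /=.
- split=> [e|/big_and_sat h]; last first.
    by congr App; apply/funext => i; exact: (h i).
  apply/big_and_sat => i /=.
  (* The type of the arguments depends on the symbol, so injectivity of [App] first gives an
     equality of dependent pairs. *)
  have := inj_pair2_eq_dec _ (fun f g => pselect (f = g)) _ _ _ _ (f_equal
    (fun t : term L => if t is App g b return {h & 'I_(farity h) -> term L}
       then existT (fun h => 'I_(farity h) -> term L) g b
       else existT (fun h => 'I_(farity h) -> term L) f (fun=> Var 0)) e).
  by move=> /(congr1 (fun a => a i)).
- by split=> // -[].
- split=> // e; case: t xt xin e => [y /= xy|f a _ /flatten_mapP[i _ xi] e].
    by rewrite inE => /eqP xy'; rewrite xy' in xy.
  have := tsize_arg (fun j => subst v (a j)) i.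
  by rewrite -[App _ _]e ltnNge (tsize_subst_ge v xi).
Qed.

(** * Composition with substitutions, and its effect on variables and sizes *)

Lemma eval_ext (L : language) (M : structure L) (v w : valuation M) (t : term L) :
  {in tvars t, v =1 w} -> eval v t = eval w t.
Proof.
elim: t => [x|f a IH] /= h; first by apply: h; rewrite inE.
congr finterp; apply/funext => i; apply: IH => x xi.
by apply: h; apply: (tvars_arg (i := i)).
Qed.

Definition comp_val (L : language) (M : structure L) (w : valuation M)
    (s : substitution L) : valuation M := fun x => eval w (s x).

Lemma eval_subst (L : language) (M : structure L) (w : valuation M)
    (s : substitution L) (t : term L) :
  eval w (subst s t) = eval (comp_val w s) t.
Proof. by elim: t => //= f a IH; congr finterp; apply/funext => i; exact: IH. Qed.

Lemma comp_valA (L : language) (M : structure L) (w : valuation M)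
    (s1 s2 : substitution L) :
  comp_val w (comp_val s1 s2) = comp_val (comp_val w s1) s2.
Proof. by apply/funext => x; exact: eval_subst. Qed.

Lemma comp_id_val (L : language) (s : substitution L) :
  comp_val (Var : substitution L) s = s.
Proof. by apply/funext => x; exact: subst_id. Qed.

Lemma tvars_subst (L : language) (s : substitution L) (t : term L) :
  tvars (subst s t) = flatten [seq tvars (s x) | x <- tvars t].
Proof.
elim: t => [x|f a IH] /=; first by rewrite cats0.
elim: (enum _) => //= i e ->.
by rewrite map_cat flatten_cat -IH.
Qed.

(** Each variable occurrence, of size 1, is replaced by its image; [tvars] keeps repetitions. Both
    sides are sums to avoid truncated subtraction. *)
Lemma tsize_subst (L : language) (s : substitution L) (t : term L) :
  tsize (subst s t) + size (tvars t) = tsize t + \sum_(x <- tvars t) tsize (s x).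
Proof.
elim: t => [x|f a IH] /=; first by rewrite big_seq1 addnC.
elim: (enum _) => [|i e]; rewrite ?big_nil //= ?big_nil //.
rewrite !big_cons size_cat big_cat /=; move: (IH i); rewrite /subst; lia.
Qed.

Lemma size_tvars (L : language) (t : term L) :
  size (tvars t) <= tsize t ?= iff (if t is Var _ then true else false).
Proof.
apply/leqifP; case: t => [x|f a] //=; rewrite ltnS.
have: forall i, size (tvars (a i)) <= tsize (a i).
  move=> i; elim: (a i) => //= g b IH; apply: leqW.
  elim: (enum _) => [|j e]; rewrite ?big_nil //= big_cons size_cat => h.
  exact: leq_add.
move=> h; elim: (enum _) => [|j e]; rewrite ?big_nil //= big_cons size_cat.
exact: leq_add.
Qed.

(* [s] is a most general solution of [Q], uniformly in the model of FEA. *)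
Definition mgs (L : language) (Q : forall M : structure L, valuation M -> Prop)
    (s : substitution L) : Prop :=
  forall M, FEA_model M -> forall v : valuation M,
    Q M v <-> exists w : valuation M, v = comp_val w s.

Definition resolved (L : language)
    (Q : forall M : structure L, valuation M -> Prop) : Prop :=
  (forall M, FEA_model M -> forall v : valuation M, ~ Q M v) \/
  (exists s, mgs Q s).

Lemma resolved_ext (L : language)
    (Q Q' : forall M : structure L, valuation M -> Prop) :
  (forall M, FEA_model M -> forall v : valuation M, Q M v <-> Q' M v) ->
  resolved Q -> resolved Q'.
Proof.
move=> h [un|[s hs]]; [left=> M hM v /(h M hM v)|right]; first exact: un.
by exists s => M hM v; rewrite -h //; exact: hs.
Qed.

(** * Unification of finite systems of equations *)

Fixpoint sat_eqs (L : language) (l : seq (term L * term L)) (M : structure L)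
    (v : valuation M) : Prop :=
  if l is e :: l' then eval v e.1 = eval v e.2 /\ sat_eqs l' v else True.

Definition subst_eqs (L : language) (s : substitution L)
    (l : seq (term L * term L)) : seq (term L * term L) :=
  [seq (subst s e.1, subst s e.2) | e <- l].

Definition vars_eqs (L : language) (l : seq (term L * term L)) : seq nat :=
  flatten [seq tvars e.1 ++ tvars e.2 | e <- l].

Definition size_eqs (L : language) (l : seq (term L * term L)) : nat :=
  \sum_(e <- l) (tsize e.1 + tsize e.2).

Lemma sat_eqs_subst (L : language) (s : substitution L) l (M : structure L)
    (w : valuation M) :
  sat_eqs (subst_eqs s l) w <-> sat_eqs l (comp_val w s).
Proof. by elim: l => //= e l IH; rewrite !eval_subst IH. Qed.

Lemma sat_eqs_cat (L : language) (l1 l2 : seq (term L * term L)) (M : structure L)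
    (w : valuation M) :
  sat_eqs (l1 ++ l2) w <-> sat_eqs l1 w /\ sat_eqs l2 w.
Proof. by elim: l1 => [|e l1 IH] /=; rewrite ?IH; intuition. Qed.

Lemma subst_single_fresh (L : language) (x : nat) (t u : term L) :
  x \notin tvars t -> subst (update (Var : substitution L) x u) t = t.
Proof.
move=> xt; rewrite -[RHS]subst_id; apply: (@eval_ext _ (term_algebra L)) => y yt.
by rewrite /update; case: eqP => // yx; rewrite -yx yt in xt.
Qed.

Lemma tvars_subst_single (L : language) (x : nat) (t u : term L) :
  x \notin tvars u ->
  {subset tvars (subst (update (Var : substitution L) x u) t) <=
     [seq y <- tvars t ++ tvars u | y != x]}.
Proof.
move=> xu y; rewrite tvars_subst => /flatten_mapP[z zt].
rewrite mem_filter mem_cat /update; case: eqP => [_ yu|zx]; last first.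
  by rewrite inE => /eqP ->; rewrite zt andbT; apply/eqP.
by rewrite yu orbT andbT; apply: contraNneq xu => <-.
Qed.

(** A valuation solves x = t exactly when composing it with the substitution of t for x leaves it
    unchanged. Hence a most general solution of the substituted system, composed with this
    substitution, is one of the whole system. *)
Lemma resolved_elim (L : language) (x : nat) (t : term L) l :
  x \notin tvars t ->
  resolved (sat_eqs (subst_eqs (update (Var : substitution L) x t) l)) ->
  resolved (sat_eqs ((Var x, t) :: l)).
Proof.
move=> xt; set s := update _ _ _.
have fix_s (M : structure L) (w : valuation M) :
    w x = eval w t -> w = comp_val w s.
  move=> wx; apply/funext => y; rewrite /comp_val /s /update.
  by case: eqP => // ->.
have st : subst s t = t by exact: subst_single_fresh.
case=> [un|[r hr]].
  left=> M hM w /= [/fix_s e]; rewrite e => /sat_eqs_subst.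
  exact: un.
right; exists (comp_val r s : substitution L) => M hM w /=.
split=> [[/fix_s e]|[w' ->]].
  rewrite {1}e => /sat_eqs_subst /(hr M hM)[w' e'].
  by exists w'; rewrite comp_valA -e'.
rewrite comp_valA; set u := comp_val w' r; split.
  by rewrite -eval_subst st /comp_val /s /update eqxx.
by apply/sat_eqs_subst/(hr M hM); exists w'.
Qed.

(** Lexicographic induction on the length of a list [X] containing all variables, then on the total
    size. Eliminating a variable shortens [X]; decomposing an equation or dropping a trivial one
    keeps [X] and lowers the size. *)
Lemma unification (L : language) (l : seq (term L * term L)) :
  resolved (sat_eqs l).
Proof.
have [X] : exists X : seq nat, {subset vars_eqs l <= X} by exists (vars_eqs l).
have [n] := ubnP (size X); elim: n => // n IHn in X l *.
have [m] := ubnP (size_eqs l); elim: m => // m IHm in l *.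
case: l => [_ _ _|[s t] l].
  right; exists Var => M hM v /=; split=> // _; exists v.
  by apply/funext.
rewrite {1}/size_eqs big_cons -/(size_eqs l) /= !ltnS => lem leX.
rewrite /vars_eqs /= -/(vars_eqs l) => sub.
have subs : {subset tvars s <= X} by move=> y ys; rewrite sub // !mem_cat ys.
have subt : {subset tvars t <= X}.
  by move=> y yt; rewrite sub // !mem_cat yt orbT.
have subl : {subset vars_eqs l <= X}.
  by move=> y yl; rewrite sub // !mem_cat yl !orbT.
have lel : size_eqs l < m by move: lem (tsize_gt0 s); lia.
(* An equation with a variable on one side is trivial, refuted by the occurs check, or used for
   elimination. *)
have elim x u : x \in X -> {subset tvars u <= X} ->
    resolved (sat_eqs ((Var x, u) :: l)).
  move=> xX subu; case: (boolP (x \in tvars u)) => [xu|xu].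
    case: (pselect (Var x = u)) => [<-|ne].
      apply: resolved_ext (IHm _ lel _ subl) => // M hM v /=.
      by split=> [|[]].
    left=> M hM v /= [e _].
    by have /= [/(_ e)] := hM _ (FEA_occur ne (iffRL (occurs_tvars _ _) xu)) v.
  apply: resolved_elim => //; apply: (IHn [seq y <- X | y != x]).
    apply: leq_trans leX.
    rewrite size_filter -(count_predC (fun y => y != x) X) -addn1 leq_add2l.
    by rewrite -has_count; apply/hasP; exists x => //=; rewrite negbK.
  have key v : {subset tvars v <= X} ->
     {subset tvars (subst (update (Var : substitution L) x u) v) <=
        [seq y <- X | y != x]}.
    move=> subv y /(tvars_subst_single xu).
    by rewrite !mem_filter mem_cat => /andP[-> /orP[/subv|/subu]] ->.
  move=> y /flatten_mapP[_ /mapP[e el ->]] /=.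
  have subel : {subset tvars e.1 ++ tvars e.2 <= X}.
    by move=> z ze; apply/subl/flatten_mapP; exists e.
  by rewrite mem_cat => /orP[] /key; apply=> z ze; apply: subel;
     rewrite mem_cat ze ?orbT.
case: s lem sub subs => [x|f a] lem sub subs.
  by apply: elim => //; apply: subs; rewrite inE.
case: t lem sub subt => [y|g b] lem sub subt.
  apply: resolved_ext (elim y (App f a) _ subs) => [M hM v|].
    by rewrite /=; split=> -[-> ?].
  by apply: subt; rewrite inE.
case: (pselect (f = g)) => [fg|ne]; last first.
  by left=> M hM v /= [/(FEA_model_clash hM)].
case: g / fg b lem sub subt => b lem sub subt.
apply: (@resolved_ext _
    (sat_eqs ([seq (a i, b i) | i <- enum 'I_(farity f)] ++ l))).
  move=> M hM v; rewrite sat_eqs_cat /=.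
  suff -> : sat_eqs [seq (a i, b i) | i <- enum 'I_(farity f)] v <->
    forall i, i \in enum 'I_(farity f) -> eval v (a i) = eval v (b i).
    split=> -[h hl]; split=> //.
      by congr finterp; apply/funext => i; apply: h; rewrite mem_enum.
    by move=> i _; move: (FEA_model_inj hM h) => /(congr1 (fun c => c i)).
  elim: (enum _) => [|j e IH] /=; first by split.
  rewrite IH; split=> [[h0 h] i|h].
    by rewrite inE => /predU1P[->|/h].
  by split=> [|i ie]; apply: h; rewrite inE ?eqxx // ie orbT.
apply: IHm => //.
  move: lem; rewrite [size_eqs (_ ++ _)]big_cat big_map big_split /=.
  by rewrite -/(size_eqs l); lia.
move=> y /flatten_mapP[e]; rewrite mem_cat => /orP[/mapP[i _ ->]|el] /=.
  by rewrite mem_cat => /orP[/tvars_arg /subs|/tvars_arg /subt].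
by move=> ye; apply/subl/flatten_mapP; exists e.
Qed.

(** * Most general solutions of E-formulas *)

(** The substitution [s] is carried through the induction so that, in a conjunction, the second
    conjunct can be solved among the instances of the solution of the first. *)
Lemma Eformula_resolved (L : language) (A : formula L) (s : substitution L) :
  is_Eformula A -> resolved (fun M (w : valuation M) => sat (comp_val w s) A).
Proof.
elim: A s => //=.
- move=> s _; right; exists Var => M hM v; split=> // _; exists v.
  exact/funext.
- by move=> s _; left=> M hM v.
- move=> t u s _.
  apply: resolved_ext (unification [:: (subst s t, subst s u)]) => M hM v /=.
  by rewrite !eval_subst; intuition.
- move=> B IHB C IHC s /andP[/(IHB s) [un|[r hr]] hC].
    by left=> M hM v [/(un M hM)].
  case: (IHC (comp_val r s : substitution L) hC) => [un|[q hq]].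
    left=> M hM v [/(hr M hM)[w ->]].
    by rewrite -comp_valA; exact: un.
  right; exists (comp_val q r : substitution L) => M hM v; split.
    case=> /(hr M hM)[w ->]; rewrite -comp_valA => /(hq M hM)[w' ->].
    by exists w'; rewrite comp_valA.
  case=> w' ->; rewrite comp_valA; split; first by apply/(hr M hM); eexists.
  by rewrite -comp_valA; apply/(hq M hM); exists w'.
- move=> x B IHB s hB.
  (* The variables of [s] are shifted to make [Var 0] fresh for the witness. *)
  pose shift : substitution L := fun n => Var n.+1.
  pose s' : substitution L := update (comp_val shift s : substitution L) x (Var 0).
  pose consv (M : structure L) (d : M) (w : valuation M) : valuation M :=
    fun n => if n is m.+1 then w m else d.
  have s'E (M : structure L) (d : M) (w : valuation M) :
      comp_val (consv M d w) s' = update (comp_val w s) x d.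
    apply/funext => y; rewrite /comp_val /s' /update; case: eqP => // _.
    by rewrite [LHS](eval_subst _ shift).
  case: (IHB s' hB) => [un|[r hr]].
    by left=> M hM w [d]; rewrite -s'E; exact: un.
  (* In the solution [r] of the body, [r 0] describes the witness and the later entries the
     valuation; quantifying drops the entry 0. *)
  right; exists (fun n => r n.+1) => M hM w; split.
    case=> d; rewrite -s'E => /(hr M hM)[w' e]; exists w'.
    by apply/funext => n; have /= := congr1 (fun v => v n.+1) e.
  case=> w' ->; exists (eval w' (r 0)); rewrite -s'E.
  by apply/(hr M hM); exists w'; apply/funext => -[].
Qed.

Lemma Eformula_mgs (L : language) (E : Eformula L) :
  resolved (fun M (v : valuation M) => sat v (val E)).
Proof.
apply: resolved_ext (Eformula_resolved Var (valP E)) => M hM v.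
by have -> : comp_val v Var = v by apply/funext.
Qed.

(** * The rank of a tuple of terms and its growth under substitution *)

Lemma size_undup_cat (T : eqType) (s t : seq T) :
  size (undup (s ++ t)) <= size s + size (undup t) /\
  (size (undup (s ++ t)) = size s + size (undup t) ->
   forall x, x \in s -> x \notin t).
Proof.
rewrite undup_cat size_cat; have := count_size (fun x => x \notin t) (undup s).
rewrite -size_filter; have := size_undup s => le2 le1.
split=> [|e x xs]; first by rewrite leq_add2r (leq_trans le1).
have : all (fun x => x \notin t) (undup s).
  by rewrite all_count -size_filter; apply/eqP; move: e le1 le2 => /=; lia.
by move=> /allP/(_ x); rewrite mem_undup; apply.
Qed.

(** Meant for [g] the variables and [c] the size of the image of a variable. By induction on [l]: a
    repeated entry adds 1 on the left and [c x] on the right; a new one adds at most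
    [1 + size (g x)] on the left and [1 + c x] on the right. Equality leaves no slack at new entries
    and forces disjoint images. *)
Lemma size_undup_flatten_map (T U : eqType) (l : seq T) (g : T -> seq U)
    (c : T -> nat) :
  (forall x, size (g x) <= c x) -> (forall x, 0 < c x) ->
  let m := size l + size (undup (flatten [seq g x | x <- l])) in
  let M := \sum_(x <- l) c x + size (undup l) in
  m <= M /\
  (m = M -> {in l, forall x, c x = size (g x)} /\
            {in l &, forall x y k, k \in g x -> k \in g y -> x = y}).
Proof.
move=> gc c0; elim: l => [|x l] /=; first by rewrite big_nil.
rewrite big_cons; set F := flatten _ => -[le IH].
have [leF disj] := size_undup_cat (g x) F.
have lec := gc x; have posc := c0 x.
have gF y : y \in l -> {subset g y <= F}.
  by move=> yl k ky; apply/flatten_mapP; exists y.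
case: ifP => [xl|/negbT xl] /=.
  have FE : size (undup (g x ++ F)) = size (undup F).
    rewrite undup_cat size_cat (_ : [seq _ <- _ | _] = [::]) //.
    apply/eqP; rewrite -[_ == _]negbK -has_filter; apply/hasPn => k.
    by rewrite mem_undup negbK => /gF; exact.
  split=> [|e]; first by lia.
  have {IH}[|IH1 IH2] := IH; first by lia.
  split=> [y|y z]; first by rewrite inE => /predU1P[->|]; exact: IH1.
  by rewrite !inE => /predU1P[->|yl] /predU1P[->|zl] //; exact: IH2.
split=> [|e]; first by lia.
have {IH}[|IH1 IH2] := IH; first by lia.
have {}disj k : k \in g x -> k \notin F by apply: disj; lia.
split=> [y|y z].
  by rewrite inE => /predU1P[->|]; [lia | exact: IH1].
rewrite !inE => /predU1P[->|yl] /predU1P[->|zl] // k.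
- by move=> /disj/negP kF /(gF z zl).
- by move=> /(gF y yl) kF /disj/negP.
- exact: IH2.
Qed.

Definition vars_terms (L : language) (ts : seq (term L)) : seq nat :=
  flatten [seq tvars t | t <- ts].

(* The subtraction never truncates, see [size_vars_terms]. *)
Definition rank (L : language) (ts : seq (term L)) : nat :=
  \sum_(t <- ts) tsize t - size (undup (vars_terms ts)).

Lemma size_vars_terms (L : language) (ts : seq (term L)) :
  size (undup (vars_terms ts)) <= \sum_(t <- ts) tsize t.
Proof.
apply: leq_trans (size_undup _) _; rewrite /vars_terms.
elim: ts => [|t ts IH] /=; first by rewrite big_nil.
by rewrite size_cat big_cons leq_add // size_tvars.
Qed.

Lemma vars_terms_subst (L : language) (s : substitution L) (ts : seq (term L)) :
  vars_terms [seq subst s t | t <- ts] =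
  flatten [seq tvars (s x) | x <- vars_terms ts].
Proof.
rewrite /vars_terms; elim: ts => //= t ts ->.
by rewrite tvars_subst map_cat flatten_cat.
Qed.

Lemma tsize_terms_subst (L : language) (s : substitution L) (ts : seq (term L)) :
  \sum_(t <- [seq subst s t | t <- ts]) tsize t + size (vars_terms ts) =
  \sum_(t <- ts) tsize t + \sum_(x <- vars_terms ts) tsize (s x).
Proof.
rewrite /vars_terms; elim: ts => [|t ts IH] /=; first by rewrite !big_nil.
by rewrite !big_cons size_cat big_cat /=; move: IH (tsize_subst s t); lia.
Qed.

(** If the rank does not grow, every variable of [ts] has an image whose size equals its number of
    variable occurrences, hence a variable, and distinct variables have distinct images; such a
    renaming can be undone. *)
Lemma rank_subst (L : language) (s : substitution L) (ts : seq (term L)) :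
  rank ts <= rank [seq subst s t | t <- ts] /\
  (rank [seq subst s t | t <- ts] <= rank ts ->
   exists r : substitution L, {in vars_terms ts, forall x, subst r (s x) = Var x}).
Proof.
have h1 := size_vars_terms ts; have h2 := size_vars_terms [seq subst s t | t <- ts].
have h3 := tsize_terms_subst s ts; rewrite /rank.
have [] := @size_undup_flatten_map _ _ (vars_terms ts) (fun x => tvars (s x))
   (fun x => tsize (s x)) (fun x => size_tvars (s x)) (fun x => tsize_gt0 (s x)).
rewrite -vars_terms_subst; move: h1 h2 h3 => /= h1 h2 h3 le eqc.
split=> [|ge]; first by lia.
have {eqc} [|isvar inj] := eqc; first by lia.
have {}isvar x : x \in vars_terms ts -> exists y, s x = Var y.
  move=> /isvar/esym/eqP; rewrite (size_tvars (s x)).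
  by case: (s x) => // y _; exists y.
(* The inverse renaming; preimages are unique by [inj], and variables outside the image are kept. *)
pose r : substitution L := fun y =>
  if pselect (exists2 x, x \in vars_terms ts & s x = Var y) is left h
  then Var (projT1 (cid2 h)) else Var y.
exists r => x xts; have [y sx] := isvar x xts; rewrite sx /subst /= /r.
case: pselect => [h|[]]; last by exists x.
case: (cid2 h) => z zts sz /=; congr Var.
by apply: (inj z x zts xts y); rewrite ?sz ?sx inE.
Qed.

(** * Entailment through most general solutions, and reduction to finitely many variables *)

(** Reduces a given E-formula to finitely many coordinates, since [rank] is defined on finite tuples
    only. *)
Lemma sat_bounded (L : language) (A : formula L) : is_Eformula A ->
  exists N, forall (M : structure L) (v w : valuation M),
    (forall n, n < N -> v n = w n) -> sat v A -> sat w A.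
Proof.
elim: A => //=; [by exists 0|by exists 0| | |].
- move=> s t _; exists (\max_(x <- tvars s ++ tvars t) x.+1) => M v w vw.
  by rewrite -(@eval_ext _ _ v w s) -?(@eval_ext _ _ v w t) // => x xt;
     apply: vw; apply: leq_bigmax_seq; rewrite // mem_cat xt ?orbT.
- move=> B IHB C IHC /andP[/IHB[N hB] /IHC[N' hC]]; exists (maxn N N').
  move=> M v w vw [/(hB _ _ w) h /(hC _ _ w) h'].
  by split; [apply: h|apply: h'] => n nN; apply: vw; rewrite leq_max nN ?orbT.
- move=> x B IHB /IHB[N hB]; exists N => M v w vw [d] /(hB _ _ (update w x d)) h.
  by exists d; apply: h => n nN; rewrite /update; case: eqP => // _; apply: vw.
Qed.

Lemma mgs_solution (L : language) (E : Eformula L) (s : substitution L) :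
  mgs (fun M (v : valuation M) => sat v (val E)) s -> sat s (val E).
Proof.
move=> hs; apply/(hs _ (@FEA_model_term_algebra L)).
by exists Var; rewrite comp_id_val.
Qed.

(** A single test in the term algebra suffices: if [s] solves [E'], it factors through the most
    general solution of [E'], and then so do all instances of [s] in every model. *)
Lemma mgs_le (L : language) (E E' : Eformula L) (s : substitution L) :
  mgs (fun M (v : valuation M) => sat v (val E)) s ->
  sat s (val E') -> Ele E E'.
Proof.
move=> hs sE' M hM v; case: (Eformula_mgs E') => [un|[r hr]].
  by case: (un _ (@FEA_model_term_algebra L) s).
have [q qs] := iffLR (hr _ (@FEA_model_term_algebra L) s) sE'.
move=> /(hs M hM)[w ->]; apply/(hr M hM); exists (comp_val w q).
by rewrite -comp_valA -qs.
Qed.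

Lemma Ele_subst (L : language) (E E' : Eformula L) (s : substitution L) :
  Ele E E' -> sat s (val E) -> sat s (val E').
Proof. exact: (fun h => h _ (@FEA_model_term_algebra L) s). Qed.

(* A solution whose values from [N] on are distinct variables that occur nowhere
   else: the first [N] values only contain even-numbered variables. *)
Definition tail_fresh (L : language) (N : nat) (s : substitution L) : Prop :=
  (forall n, n < N -> {in tvars (s n), forall x, ~~ odd x}) /\
  (forall n, N <= n -> s n = Var n.*2.+1).

(** Doubling the variable indices in a most general solution frees the odd variables for the
    coordinates from [N] on, on which [E] does not depend. *)
Lemma tail_fresh_solution (L : language) (E : Eformula L) :
  ~ Ele E (EFalse L) ->
  exists N (s : substitution L), tail_fresh N s /\ sat s (val E).
Proof.
move=> nE; have [un|[r hr]] := Eformula_mgs E.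
  by case: nE => M hM v; exact: un.
have [N hN] := sat_bounded (valP E).
pose dbl : substitution L := fun n => Var n.*2.
exists N, (fun n => if n < N then subst dbl (r n) else Var n.*2.+1).
split; first split=> n nN.
- rewrite nN tvars_subst => x /flatten_mapP[y _].
  by rewrite inE => /eqP ->; rewrite odd_double.
- by rewrite ltnNge nN.
- apply: (hN _ (comp_val dbl r)) => [n -> //|].
  by apply/(hr _ (@FEA_model_term_algebra L)); exists dbl.
Qed.

(** Let [r] be a most general solution of [E], so that [s] is an instance of it. From [N] on, [s]
    takes distinct fresh variables as values; so [r] takes distinct variables there, none occurring
    in its first [N] values. These can be reassigned freely. Thus one [N] serves all formulas solved
    by [s], whatever variables they mention. *)
Lemma tail_fresh_indep (L : language) (N : nat) (s : substitution L)
    (E : Eformula L) :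
  tail_fresh N s -> sat s (val E) ->
  forall M, FEA_model M -> forall v v' : valuation M,
  (forall n, n < N -> v n = v' n) -> sat v (val E) -> sat v' (val E).
Proof.
move=> [even fresh] sE M hM v v' vv'; have [un|[r hr]] := Eformula_mgs E.
  by move=> /(un M hM).
have [q sqr] := iffLR (hr _ (@FEA_model_term_algebra L) s) sE.
move=> /(hr M hM)[w vwr]; apply/(hr M hM).
(* Only the variables that are values of [r] from [N] on are reassigned, according to [v']. *)
pose w' : valuation M := fun u =>
  if pselect (exists2 n, N <= n & r n = Var u) is left h
  then v' (projT1 (cid2 h)) else w u.
exists w'; apply/funext => n; rewrite /comp_val.
have [nN|Nn] := ltnP n N.
  rewrite -vv' // vwr; apply: eval_ext => u ur; rewrite /w'.
  case: pselect => // -[m Nm rm].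
  have := even n nN m.*2.+1; rewrite /= odd_double => /(_ _)/negP; case=> //.
  rewrite sqr tvars_subst; apply/flatten_mapP; exists u => //.
  have := fresh m Nm; rewrite sqr /comp_val rm /= => ->.
  by rewrite inE.
have [u rn] : exists u, r n = Var u.
  have := fresh n Nn; rewrite sqr /comp_val.
  by case: (r n) => // u _; exists u.
rewrite rn /= /w'; case: pselect => [h|[]]; last by exists n.
case: (cid2 h) => m Nm rm /=; congr v'.
have := fresh m Nm; have := fresh n Nn.
by rewrite sqr /comp_val rm rn /= => -> [] /double_inj.
Qed.

Definition EAnd (L : language) (E E' : Eformula L) : Eformula L :=
  exist _ (FAnd (val E) (val E')) (introT andP (conj (valP E) (valP E'))).

(* Among the elements of [U], one whose most general solution has maximal rank
   is the least: conjoining anything to it does not increase the rank, so only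
   renames that solution. *)
Lemma Eformula_least (L : language) (E : Eformula L) (U : set (Eformula L)) :
  ~ Ele E (EFalse L) -> U (ETrue L) ->
  (forall E1 E2, U E1 -> U E2 -> U (EAnd E1 E2)) ->
  (forall E', U E' -> Ele E E') ->
  exists2 E0, U E0 & forall E', U E' -> Ele E0 E'.
Proof.
move=> /tail_fresh_solution[N [s [sfresh sE]]] U1 UA leU.
have sU E' : U E' -> sat s (val E') by move=> /leU/Ele_subst; exact.
have mgsU E' : U E' ->
    exists r, mgs (fun M (v : valuation M) => sat v (val E')) r.
  move=> /sU sE'; case: (Eformula_mgs E') => // un.
  by case: (un _ (@FEA_model_term_algebra L) s).
pose firstN (r : substitution L) := [seq r n | n <- iota 0 N].
have firstN_comp (q r : substitution L) :
    firstN (comp_val q r) = [seq subst q t | t <- firstN r].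
  by rewrite /firstN -map_comp.
pose P k := `[< exists E' r, [/\ U E',
  mgs (fun M (v : valuation M) => sat v (val E')) r & rank (firstN r) = k] >].
have exP : exists k, P k.
  have [r hr] := mgsU _ U1.
  by exists (rank (firstN r)); apply/asboolP; exists (ETrue L), r.
(* [s] is an instance of every most general solution involved, so its rank bounds theirs and a
   maximum exists. *)
have ubP k : P k -> k <= rank (firstN s).
  move=> /asboolP[E' [r [UE' hr <-]]].
  have [q ->] := iffLR (hr _ (@FEA_model_term_algebra L) s) (sU _ UE').
  by rewrite firstN_comp; have [] := rank_subst q (firstN r).
case: (ex_maxnP exP ubP) => k /asboolP[E0 [r [UE0 hr <-]]] maxk.
exists E0 => // E' UE'; have UE2 := UA _ _ UE0 UE'.
have [r2 hr2] := mgsU _ UE2.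
have [r2E0 r2E'] : sat r2 (val E0) /\ sat r2 (val E') := mgs_solution hr2.
have [q r2E] := iffLR (hr _ (@FEA_model_term_algebra L) r2) r2E0.
have [_ [|p pq]] := rank_subst q (firstN r).
  by rewrite -firstN_comp -r2E; apply: maxk; apply/asboolP; exists (EAnd E0 E'), r2.
(* It remains to see that [r] solves [E']. As [p] undoes [q] on the variables of the first [N]
   values of [r], the solution [comp_val p r2] of [E'] agrees with [r] there, and [E'] ignores the
   other coordinates. *)
apply: (mgs_le hr).
apply: (tail_fresh_indep sfresh (sU _ UE') (@FEA_model_term_algebra L)
         (v := comp_val p r2)).
  move=> n nN; rewrite r2E comp_valA -[RHS]subst_id; apply: eval_ext => x xr.
  apply: pq; apply/flatten_mapP; exists (r n) => //.
  by apply: map_f; rewrite mem_iota.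
have : sat (comp_val p r2) (val (EAnd E0 E')).
  by apply/(hr2 _ (@FEA_model_term_algebra L)); exists p.
by case.
Qed.

(** * Suprema, infima and extreme elements of the quotient *)

Lemma Eclass_repr (L : language) (p : Equot L) : Eclass (repr p) = p.
Proof. exact: reprK. Qed.

Lemma Eclass_False_le (L : language) (p : Equot L) : (Eclass (EFalse L) <= p)%O.
Proof. by rewrite -(Eclass_repr p); apply/Equot_leP => M hM v. Qed.

Lemma le_Eclass_True (L : language) (p : Equot L) : (p <= Eclass (ETrue L))%O.
Proof. by rewrite -(Eclass_repr p); apply/Equot_leP => M hM v. Qed.

Lemma Equot_supremum (L : language) (A : set (Equot L)) :
  (supremums A !=set0)%classic.
Proof.
case: (pselect (exists2 p, A p & ~ Ele (repr p) (EFalse L))) => [[p Ap np]|nA].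
  pose U := [set E | ubound A (Eclass E)]%classic.
  have [|E1 E2 U1 U2|E UE|E0 U0 leE0] := @Eformula_least L (repr p) U np.
  - by move=> q _; exact: le_Eclass_True.
  - move=> q Aq; rewrite -(Eclass_repr q); apply/Equot_leP => M hM v qv.
    have /Equot_leP h1 : (Eclass (repr q) <= Eclass E1)%O.
      by rewrite Eclass_repr; exact: U1.
    have /Equot_leP h2 : (Eclass (repr q) <= Eclass E2)%O.
      by rewrite Eclass_repr; exact: U2.
    by split; [exact: (h1 M hM v)|exact: (h2 M hM v)].
  - by apply/Equot_leP; rewrite Eclass_repr; exact: UE.
  exists (Eclass E0); split=> // q; rewrite -(Eclass_repr q) => Uq.
  exact/Equot_leP/leE0.
(* Here every member of [A], if any, is the class of False. *)
exists (Eclass (EFalse L)); split=> [p Ap|p _]; last exact: Eclass_False_le.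
rewrite -(Eclass_repr p); apply/Equot_leP.
by case: (pselect (Ele (repr p) (EFalse L))) => // np; case: nA; exists p.
Qed.

Theorem theorem5p3 (L : language) (hL : has_constant L) :
  [/\ complete_lattice (Equot L),
      (forall p : Equot L, (Eclass (EFalse L) <= p)%O) &
      (forall p : Equot L, (p <= Eclass (ETrue L))%O)].
Proof.
split; [|exact: Eclass_False_le|exact: le_Eclass_True] => A.
split; first exact: Equot_supremum.
have [p [ubp lbp]] := Equot_supremum (lbound A).
by exists p; split=> // q Aq; apply: lbp => r; exact.
Qed.
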